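(* Let $p$ be a prime and let $G$ be a finite nonabelian $p$-group of exponent $>p$ which is not minimal nonabelian. Then the following are equivalent: (i) every minimal nonabelian subgroup $S$ of $G$ is isolated in its normalizer $N_G(S)$; (ii) $p\geq 5$ and every minimal nonabelian subgroup of $G$ is isomorphic to $\mathrm{S}(p^3)$.
   Context: A subgroup $H$ of a group $K$ is isolated in $K$ if for each $x\in K$ either $x\in H$ or $\langle x\rangle\cap H=\{1\}$. A group is minimal nonabelian if it is nonabelian and all of its proper subgroups are abelian. For a prime $p$, $\mathrm{S}(p^3)$ denotes a nonabelian group of order $p^3$ and exponent $p$. *)

(* Defs.v *)
From mathcomp Require Export all_boot all_fingroup all_solvable.
Set Implicit Arguments.
Unset Strict Implicit.
Unset Printing Implicit Defensive.

Local Open Scope group_scope.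

Definition isolated (gT : finGroupType) (H K : {group gT}) : Prop :=
  H \subset K /\ forall x : gT, x \in K -> x \in H \/ <[x]> :&: H = 1.

Definition minimal_nonabelian (gT : finGroupType) (S : {group gT}) : Prop :=
  ~~ abelian S /\ forall H : {group gT}, H \proper S -> abelian H.

(* T is a model of S(p^3).  This determines T up to isomorphism for p odd;    *)
(* no such T exists for p = 2, as groups of exponent 2 are abelian.           *)
Definition is_Sp3 (p : nat) (gT : finGroupType) (T : {group gT}) : Prop :=
  [/\ ~~ abelian T, #|T| = (p ^ 3)%N & exponent T = p].

(* Main.v *)
Require Import Defs.
From mathcomp Require Import zify.

(** Subgroups generated by two elements u, v whose commutator is nontrivial,
    of order p and commutes with both are minimal nonabelian, and they can be
    produced at will in a p-group ([minimal_nonabelian_joing]); both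
    directions exhibit such a subgroup that breaks the hypothesis. The other
    tool is the expansion of (x s)^n in a group where the commutators of a =
    [s, x] with s and x are central ([expMg_class3]). When p >= 5 and a^p = 1
    all correction exponents, being built from binomials C(p, 2) and C(p, 3),
    vanish; when p = 3 the term C(3, 3) = 1 survives, which is why p = 3
    behaves differently. In a p-group, H is isolated in K exactly when no x in
    K outside H has a nontrivial p-th power in H ([isolated_pgroupP]).

    From (ii) to (i): if every minimal nonabelian subgroup has exponent p >= 5
    and S is one of them, then N_G(S) even has exponent p. If T < S has order
    p^2 and is normal in N_G(S), an element x with x^p != 1 must centralize T,
    as otherwise x lies in a minimal nonabelian subgroup generated by x and an
    element of T. For g in S not centralizing T, (g x)^p = x^p != 1, whereas g
    x does not centralize T: a contradiction.

    From (i) to (ii): let S be minimal nonabelian. Normalizers grow in the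
    p-group G, so some x outside S normalizes S with x^p in S, and isolation
    forces the whole coset x S to consist of elements of order p. For p = 2
    this makes x invert S, so S would be abelian. For p odd, u |-> u^p is a
    homomorphism on S. If it is not trivial, choose s in S such that s^p has
    order p and is central in N_G(S). Counting shows that the commutators of
    N_G(S) with the kernel of this homomorphism are central in N_G(S)
    ([commg_ker_expg_central]); as [s, x] lies in that kernel, the expansion
    applies to (x s)^p = 1 and gives s^p = 1 when p >= 5. When p = 3,
    comparing it for s and s^-1 leaves the configuration where [s, x] commutes
    with s and s^3 = [[s, x], x]^-1; then the subgroup generated by [s, x] and
    x is minimal nonabelian, normalized by s, and not isolated
    ([three_uniserial_contradiction]). Hence S has exponent p and order p^3.

    Finally p = 3 is impossible: a subgroup K minimal among the nonabelian
    ones of exponent greater than 3 has an abelian maximal subgroup M outside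
    of which every cube is trivial, and choosing s in M with s^3 of order 3
    and central in K produces the same forbidden configuration. *)

Set Implicit Arguments.
Unset Strict Implicit.
Unset Printing Implicit Defensive.

Local Open Scope group_scope.

(** * Powers of a product when third commutators are central *)

Section CommutatorCalculus.

Variables (gT : finGroupType) (s x : gT).
Let a := [~ s, x].
Let b := [~ a, s].
Let d := [~ a, x].
Hypotheses (cbs : commute b s) (cbx : commute b x).
Hypotheses (cds : commute d s) (cdx : commute d x).

Let cba : commute b a.
Proof.
by rewrite /commute /a /commg /conjg; do ?[apply: commuteM | apply: commuteV].
Qed.

Let cda : commute d a.
Proof. by do ?[apply: commuteM | apply: commuteV]. Qed.

(** Moving every x to the left replaces the s with k factors s to its right by
    s^(x^k) = s a^k d^C(k, 2). In the resulting product each a^k moves past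
    these k factors s and leaves b^(k^2) behind, and the sum of k^2 over k < n
    is C(n, 2) + 2 C(n, 3). *)
Lemma expMg_class3 n :
  (x * s) ^+ n =
    x ^+ n * s ^+ n * a ^+ 'C(n, 2) * d ^+ 'C(n, 3)
      * b ^+ ('C(n, 2) + 2 * 'C(n, 3)).
Proof.
have cbd: commute b d by do ?[apply: commuteM|apply: commuteV].
have saX m : (s * a) ^+ m = s ^+ m * a ^+ m * b ^+ 'C(m, 2).
  by apply: expMg_Rmul; apply: commute_sym.
have asX m : a ^+ m * s = s * a ^+ m * b ^+ m.
  by rewrite (commgC (a ^+ m) s) commXg; last exact: commute_sym.
elim: n => [|n IHn]; first by rewrite !expg0 !mulg1.
have cX (u v : gT) i j : commute u v -> u ^+ i * v ^+ j = v ^+ j * u ^+ i.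
  by move=> cuv; apply: commuteX2.
have conj_x : (s ^+ n * a ^+ 'C(n, 2) * d ^+ 'C(n, 3)
                * b ^+ ('C(n, 2) + 2 * 'C(n, 3))) ^ x =
   s ^+ n * (a ^+ (n + 'C(n, 2)) * (d ^+ ('C(n, 2) + 'C(n, 3))
     * b ^+ ('C(n, 2) + ('C(n, 2) + 2 * 'C(n, 3))))).
  rewrite !conjMg !conjXg (conjg_mulR s x) (conjg_mulR a x) -/a -/d.
  have -> : d ^ x = d by apply/conjg_fixP/commgP.
  have -> : b ^ x = b by apply/conjg_fixP/commgP.
  rewrite saX (expgMn _ (commute_sym cda)) !expgD !mulgA.
  rewrite -(mulgA _ (b ^+ _) (a ^+ _)) (cX b a _ _ cba) !mulgA.
  by rewrite -!(mulgA _ (b ^+ 'C(n, 2)) (d ^+ _)) (cX b d _ _ cbd) !mulgA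
    -(mulgA _ (b ^+ 'C(n, 2)) (d ^+ _)) (cX b d _ _ cbd) !mulgA.
have -> : (x * s) ^+ n.+1 = x ^+ n.+1 * (s ^+ n * a ^+ 'C(n, 2)
   * d ^+ 'C(n, 3) * b ^+ ('C(n, 2) + 2 * 'C(n, 3))) ^ x * s.
  by rewrite expgSr IHn expgSr -!mulgA mulKVg.
rewrite conj_x -!mulgA; congr (_ * _); rewrite !mulgA expgSr -!mulgA.
congr (_ * _); rewrite !mulgA.
have cs u i : commute u s -> u ^+ i * s = s * u ^+ i.
  by move=> cus; apply/commute_sym/commuteX/commute_sym.
rewrite -!(mulgA _ (b ^+ _)) (cs b _ cbs) !mulgA.
rewrite -(mulgA _ (d ^+ _)) (cs d _ cds).
rewrite !mulgA asX -!mulgA; do 2!congr (_ * _).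
  by rewrite binS bin1 addnC.
rewrite !mulgA (cX b d _ _ cbd) -!mulgA -expgD; congr (_ ^+ _ * _ ^+ _).
  by rewrite binS addnC.
by rewrite !binS !bin1; lia.
Qed.

(** For p >= 5 both C(p, 2) and C(p, 3) are divisible by p; this is the
    regularity of groups of class less than p in the case needed here. *)
Lemma expMg_class3_prime p : prime p -> 4 < p -> a ^+ p = 1 ->
  (x * s) ^+ p = x ^+ p * s ^+ p.
Proof.
move=> p_pr p_gt4 ap1.
have bp1: b ^+ p = 1 by rewrite -commXg ?ap1 ?comm1g //; apply: commute_sym.
have dp1: d ^+ p = 1 by rewrite -commXg ?ap1 ?comm1g //; apply: commute_sym.
have eX1 (u : gT) m : u ^+ p = 1 -> p %| m -> u ^+ m = 1.
  by move=> up1 /dvdnP[k ->]; rewrite mulnC expgM up1 expg1n.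
have p2: p %| 'C(p, 2) by rewrite prime_dvd_bin //; lia.
have p3: p %| 'C(p, 3) by rewrite prime_dvd_bin //; lia.
rewrite expMg_class3 (eX1 a) // (eX1 d) // (eX1 b) ?mulg1 //.
by rewrite dvdn_add ?dvdn_mull.
Qed.

(** For n = 3 the exponents of a, d and b are 3, 1 and 5. *)
Lemma expMg_class3_three :
  a ^+ 3 = 1 -> x ^+ 3 = 1 -> (x * s) ^+ 3 = 1 -> s ^+ 3 * d * b ^+ 2 = 1.
Proof.
move=> a3 x3 <-; rewrite expMg_class3 x3 a3 mul1g mulg1 expg1.
have b3: b ^+ 3 = 1 by rewrite -commXg ?a3 ?comm1g //; apply: commute_sym.
by rewrite (_ : _ + _ = 3 + 2)%N // expgD b3 mul1g.
Qed.

End CommutatorCalculus.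

(** Passing from s to s^-1 keeps b and inverts d, so comparing the two products
    separates the parts played by b and d. *)
Lemma commVg_class3 (gT : finGroupType) (s x a b d : gT) :
  [~ s, x] = a -> [~ a, s] = b -> [~ a, x] = d ->
  commute b s -> commute b x -> commute b a -> commute d a ->
  [/\ [~ s^-1, x] = b * a^-1, [~ b * a^-1, s^-1] = b & [~ b * a^-1, x] = d^-1].
Proof.
move=> Da Db Dd cbs cbx cba cda.
have ax: a ^ x = a * d by rewrite conjg_mulR Dd.
have bx: b ^ x = b by apply/conjg_fixP/commgP.
have bsV: b ^ s^-1 = b by apply/conjg_fixP/commgP/commuteV.
have asV: a ^ s^-1 = a * b^-1.
  by apply: (mulIg b); rewrite mulgKV -{1}bsV -conjMg -Db -conjg_mulR conjgK.
split.
- rewrite commgEl invgK conjVg conjg_mulR Da invMg.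
  by rewrite -{1}(invgK s) -conjgE conjVg asV invMg invgK.
- rewrite commgEl conjMg conjVg asV bsV !invMg !invgK.
  by rewrite -mulgA mulKg mulgA -cba mulgK.
rewrite commgEl conjMg conjVg ax bx !invMg invgK.
by rewrite -mulgA mulKg mulgA (commuteV (commute_sym cda)) mulgK.
Qed.

(** * Minimal nonabelian p-groups *)

Section MinimalNonabelian.

Variables (gT : finGroupType) (p : nat).
Implicit Types (u v x : gT) (G H S : {group gT}).

Lemma minimal_nonabelian_exists G : ~~ abelian G ->
  exists2 S : {group gT}, S \subset G & minimal_nonabelian S.
Proof.
move=> nabG; pose P (S : {group gT}) := ~~ abelian S.
have [S minS sSG] := @mingroup_exists _ P G nabG; exists S => //.
split=> [|H prH]; first exact: mingroupp minS.
apply/negPn/negP=> nabH; have := prH.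
by rewrite (mingroupP minS).2 ?properxx ?proper_sub.
Qed.

(** The Frattini quotient is elementary abelian, so its logarithmic order is
    its number of generators. *)
Lemma logn_quotient_Phi_joing u v (S := (<[u]> <*> <[v]>)%G) :
  p.-group S -> logn p #|S / 'Phi(S)| <= 2.
Proof.
move=> pS; have abS := Phi_quotient_abelem pS.
rewrite -rank_abelem // -grank_abelian ?(abelem_abelian abS) //.
apply: leq_trans (quotient_grank (gFnorm _ _)) _.
rewrite /S /= joing_idl joing_idr; apply: leq_trans (grank_min _) _.
by rewrite -[_ :|: _]/[set u; v] cards2; case: (_ != _).
Qed.

(** Taking p-th powers kills the commutators, so the Frattini subgroup,
    generated by S' and the p-th powers, is central in S; a maximal subgroup
    is then cyclic modulo a central subgroup, because S modulo its Frattini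
    subgroup has order at most p^2. *)
Lemma minimal_nonabelian_joing u v (z := [~ u, v]) :
  prime p -> p.-group (<[u]> <*> <[v]>) ->
  z != 1 -> commute z u -> commute z v -> z ^+ p = 1 ->
  minimal_nonabelian (<[u]> <*> <[v]>)%G.
Proof.
move=> p_pr; set S := (<[u]> <*> <[v]>)%G => pS ntz czu czv zp1.
have Su: u \in S by rewrite mem_gen // inE cycle_id.
have Sv: v \in S by rewrite mem_gen // inE cycle_id orbT.
have zC: z \in 'C(S).
  rewrite -sub_cent1 join_subG !cycle_subG.
  by apply/andP; split; apply/cent1P.
have Sz: z \in S by rewrite groupR.
have dS: S^`(1) = <[z]> by apply: der1_joing_cycles.
have sPhiZ: 'Phi(S) \subset 'Z(S).
  rewrite (Phi_joing pS) join_subG dS cycle_subG inE Sz zC /=.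
  rewrite (MhoE 1 pS) gen_subG; apply/subsetP=> _ /imsetP[g Sg ->].
  rewrite inE groupX //=; apply/centP=> h Sh; apply/commgP.
  have: [~ g, h] \in <[z]> by rewrite -dS mem_commg.
  case/cycleP=> k Dk; rewrite commXg Dk ?expn1.
    by rewrite -expgM mulnC expgM zp1 expg1n.
  by apply: commuteX; apply: commute_sym; apply: (centP zC).
split=> [|H prH].
  by apply: contra ntz => cSS; apply/commgP/(centsP cSS).
have [eqHS | [M maxM sHM]] := maximal_exists (proper_sub prH).
  by rewrite eqHS properxx in prH.
apply: abelianS sHM _; have sMS := maxgroupp (maxM).
have sMS' := proper_sub sMS.
have sPhiM := Phi_sub_max maxM.
apply: (@cyclic_factor_abelian _ 'Phi(S)).
  by rewrite subsetI sPhiM (subset_trans sPhiZ) // subIset // orbC (centS sMS').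
have abS := Phi_quotient_abelem pS.
rewrite (abelem_cyclic (abelemS (quotientS _ sMS') abS)).
rewrite -ltnS (leq_trans _ (logn_quotient_Phi_joing pS)) //.
apply: properG_ltn_log; first exact: abelem_pgroup abS.
by rewrite quotient_proper ?gFnormal // (normalS sPhiM sMS') // gFnormal.
Qed.

(** Noncommuting u and v generate S. Adjoining a single w to the Frattini
    subgroup gives a proper, hence abelian, subgroup since S is not cyclic; so
    the Frattini subgroup is central, and [u, v]^p = [u^p, v] = 1. *)
Lemma minimal_nonabelian_pgroup S :
  prime p -> p.-group S -> minimal_nonabelian S ->
  [/\ 'Phi(S) \subset 'Z(S), #|S^`(1)| = p & logn p #|S / 'Phi(S)| <= 2].
Proof.
move=> p_pr pS [nabS abS].
have /subsetPn[u Su] := nabS; rewrite -sub_cent1 => /subsetPn[v Sv nCuv].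
have gen_uv (H : {group gT}) : H \subset S -> u \in H -> v \in H -> H :=: S.
  move=> sHS Hu Hv; apply/eqP; apply: contraNT nCuv => neHS.
  have /abS/centsP cHH: H \proper S by rewrite properEneq neHS.
  by apply/cent1P/cHH.
have defS : <[u]> <*> <[v]> = S.
  by apply: gen_uv; rewrite ?join_subG ?cycle_subG ?Su ?mem_gen //
    inE cycle_id ?orbT.
have cycN (w : gT) : w \in S -> <[w]> :=: S -> False.
  by move=> Sw eS; case/negP: nabS; rewrite -eS cycle_abelian.
have PhiC w g : w \in S -> g \in 'Phi(S) -> commute g w.
  move=> Sw Phig; have PrS : 'Phi(S) <*> <[w]> \proper S.
    rewrite properEneq join_subG Phi_sub cycle_subG Sw !andbT.
    apply/eqP=> /Phi_nongen.
    by rewrite genGid; apply: cycN.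
  have /centsP cPP := abS (_ <*> _)%G PrS.
  by apply: cPP; rewrite mem_gen // inE ?Phig ?cycle_id ?orbT.
have sPhiZ: 'Phi(S) \subset 'Z(S).
  rewrite subsetI Phi_sub; apply/centsP=> g Phig w Sw; exact: PhiC.
have S'Phi: S^`(1) \subset 'Phi(S) by rewrite (Phi_joing pS) joing_subl.
pose z := [~ u, v]; have Phiz: z \in 'Phi(S).
  by rewrite (subsetP S'Phi) // mem_commg.
have dS: S^`(1) = <[z]>.
  rewrite -defS; apply: der1_joing_cycles.
  by rewrite defS; apply/centP=> w Sw; apply: PhiC.
have zp1: z ^+ p = 1.
  rewrite -commXg; last by apply/commute_sym/PhiC.
  apply/eqP/commgP; apply: PhiC => //.
  rewrite (Phi_joing pS) mem_gen // inE; apply/orP; right.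
  by rewrite (MhoE 1 pS) mem_gen //; apply/imsetP; exists u.
have ntz : z != 1 by apply: contra nCuv => /commgP/cent1P; rewrite cent1C.
split=> //; last first.
  have pUV: p.-group (<[u]> <*> <[v]>) by rewrite defS.
  have := logn_quotient_Phi_joing pUV.
  by rewrite (_ : (<[u]> <*> <[v]>)%G = S) //; apply: val_inj.
by rewrite dS -orderE; apply: nt_prime_order.
Qed.

(** In exponent p the Frattini subgroup reduces to S', so |S| is at most
    p * p^2; and groups of order at most p^2 are abelian. *)
Lemma minimal_nonabelian_Sp3 S :
  prime p -> p.-group S -> minimal_nonabelian S -> exponent S %| p ->
  is_Sp3 p S.
Proof.
move=> p_pr pS minS expS.
have [_ oS' lS] := minimal_nonabelian_pgroup p_pr pS minS.
have [nabS _] := minS.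
have eS: exponent S = p.
  have [_ /(_ _ expS)/orP[/eqP e1|/eqP//]] := primeP p_pr.
  have /eqP S1: S :==: 1 by rewrite trivg_exponent e1.
  by rewrite S1 abelian1 in nabS.
split=> //.
have defPhi: 'Phi(S) = S^`(1).
  rewrite (Phi_joing pS) (MhoE 1 pS) expn1; apply/joing_idPl.
  rewrite gen_subG; apply/subsetP=> _ /imsetP[g Sg ->].
  by rewrite -eS expg_exponent.
have oS: #|S| = (p * #|S / 'Phi(S)|)%N.
  rewrite card_quotient ?gFnorm // -(Lagrange (Phi_sub S)).
  by rewrite /= defPhi oS'.
have [k ok] := p_natP (quotient_pgroup 'Phi(S) pS).
rewrite ok pfactorK // in lS.
rewrite oS ok -expnS; congr (_ ^ _)%N.
apply/eqP; rewrite eqn_leq ltnS lS /= ltnNge; apply: contra nabS => lek.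
by apply: (p2group_abelian pS); rewrite oS ok -expnS pfactorK.
Qed.

(** S has class 2 and S' has order p, which for odd p divides C(p, 2). *)
Lemma minimal_nonabelian_expMn S :
  prime p -> p != 2 -> p.-group S -> minimal_nonabelian S ->
  {in S &, {morph (fun u => u ^+ p) : u v / u * v}}.
Proof.
move=> p_pr p_neq2 pS minS u v Su Sv /=.
have [/subsetIP[_ cPhi] oS' _] := minimal_nonabelian_pgroup p_pr pS minS.
have S'z: [~ v, u] \in S^`(1) by rewrite mem_commg.
have cz w : w \in S -> commute w [~ v, u].
  move=> Sw; apply: commute_sym; apply: (centsP cPhi) => //.
  by rewrite (Phi_joing pS) mem_gen // inE S'z.
rewrite expMg_Rmul; try exact: cz.
have /dvdnP[k ->]: p %| 'C(p, 2).
  by rewrite prime_dvd_bin //= ltn_neqAle eq_sym p_neq2 prime_gt1.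
have zp1: [~ v, u] ^+ p = 1 by rewrite -oS' expg_cardG.
by rewrite mulnC expgM zp1 expg1n mulg1.
Qed.

End MinimalNonabelian.

(** * Isolated subgroups and central sections of p-groups *)

Section PGroups.

Variables (gT : finGroupType) (p : nat).
Implicit Types (x : gT) (G H K S : {group gT}).

Lemma exists_expg_enters S x :
  p.-elt x -> x \notin S ->
  exists m, x ^+ (p ^ m) \notin S /\ x ^+ (p ^ m) ^+ p \in S.
Proof.
move=> px Sx; have ex_m: exists m, x ^+ (p ^ m) \in S.
  by have [m om] := p_natP px; exists m; rewrite -om expg_order.
case: (ex_minnP ex_m) => [[|m] Sm min_m]; first by rewrite Sm in Sx.
exists m; rewrite -expgM -expnSr; split=> //.
by apply/negP=> /min_m; rewrite ltnn.
Qed.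

(** If x is outside S, the last of x, x^p, x^(p^2), ... outside S is some y with
    y^p in S. Were y^p trivial, y would generate the only subgroup of order p
    of the cyclic group of x, which lies in every nontrivial subgroup of it. *)
Lemma isolated_pgroupP S K :
  prime p -> p.-group K -> S \subset K ->
  isolated S K <->
  (forall x, x \in K -> x ^+ p \in S -> x ^+ p != 1 -> x \in S).
Proof.
move=> p_pr pK sSK; split=> [[_ isoS] x Kx Sxp ntxp | isoS].
  have [//|tiS] := isoS x Kx; case/eqP: ntxp; apply/set1P.
  by rewrite -[[set 1]]tiS inE mem_cycle.
split=> // x Kx; case Sx: (x \in S); first by left.
right; apply/eqP; have px: p.-elt x := mem_p_elt pK Kx.
have [m [nSy Syp]] := exists_expg_enters px (negbT Sx).
set y := x ^+ (p ^ m) in nSy Syp; apply: contraR nSy => ntiS.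
have [yp1|ntyp] := eqVneq (y ^+ p) 1; last by apply: isoS => //; apply: groupX.
have pI: p.-group (<[x]> :&: S) := pgroupS (subsetIl _ _) px.
have [_ pdvI _] := pgroup_pdiv pI ntiS.
have sy: <[y]> \subset <[x]> by rewrite cycle_subG mem_cycle.
suffices: <[y]> \subset <[x]> :&: S by rewrite cycle_subG inE => /andP[].
rewrite -(cardSg_cyclic (cycle_cyclic x)) ?subsetIl //.
by apply: dvdn_trans pdvI; rewrite -orderE order_dvdn yp1.
Qed.

(** Normalizers grow in G, so some x in N_G(S) has order p modulo S; so does
    each x s, and isolation makes the p-th power of x s, which lies in S,
    trivial. *)
Lemma isolated_coset_expg1 G S :
  prime p -> p.-group G -> S \proper G -> isolated S 'N_G(S)%G ->
  exists x, [/\ x \in 'N_G(S), x \notin S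
               & forall s, s \in S -> (x * s) ^+ p = 1].
Proof.
move=> p_pr pG prSG isoS; have sSG := proper_sub prSG.
have pN: p.-group 'N_G(S)%G := pgroupS (subsetIl _ _) pG.
have sSN: S \subset 'N_G(S)%G by rewrite subsetI sSG normG.
have /properP[_ [y Ny nSy]] := nilpotent_proper_norm (pgroup_nil pG) prSG.
have [m [nSx Sxp]] := exists_expg_enters (mem_p_elt pN Ny) nSy.
set x := y ^+ _ in nSx Sxp; have Nx: x \in 'N_G(S) by rewrite groupX.
exists x; split=> // s Ss.
have nSxs: x * s \notin S by rewrite groupMr.
have Nxs: x * s \in 'N_G(S) by rewrite groupM // (subsetP sSN).
apply/eqP; apply: contraR nSxs => ntxs.
have iso := (isolated_pgroupP p_pr pN sSN).1 isoS; apply: iso => //.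
have [nx ns] : x \in 'N(S) /\ s \in 'N(S).
  by case/setIP: Nx => _ ->; rewrite (subsetP (normG S)).
apply: coset_idr; first by rewrite groupX // groupM.
rewrite morphX ?groupM // morphM //= (coset_id Ss) mulg1.
by rewrite -morphX //= coset_id.
Qed.

(** If x and all x s are involutions then x inverts every element of S. *)
Lemma coset_expg1_odd S x : x \in 'N(S) -> ~~ abelian S ->
  (forall s, s \in S -> (x * s) ^+ p = 1) -> p != 2.
Proof.
move=> nSx nabS xS; apply: contra nabS => /eqP p2; rewrite {}p2 in xS.
have x2: x * x = 1 by have := xS 1 (group1 S); rewrite mulg1 expgS expg1.
have invS s : s \in S -> s ^ x = s^-1.
  move=> Ss; apply/eqP; rewrite eq_sym eq_invg_mul; apply/eqP.
  have xs2 : x * (s * (x * (s * x))) = x.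
    have := xS s Ss; rewrite expgS expg1 => xs2.
    by rewrite !mulgA -(mulgA (x * s)) xs2 mul1g.
  rewrite conjgE (_ : x^-1 = x); last by apply/eqP; rewrite eq_invg_mul x2.
  by apply: (mulgI x); rewrite xs2 mulg1.
apply/centsP=> u Su v Sv; apply: (conjg_inj x).
by rewrite conjMg !invS ?groupM // invMg.
Qed.

(** A normal subgroup of order p in the p-group H / C is central. *)
Lemma commg_section_prime (H N C : {group gT}) :
  p.-group H -> N <| H -> C <| H -> logn p #|N / C| <= 1 ->
  [~: N, H] \subset C.
Proof.
move=> pH nsNH nsCH lNC; have nCH := normal_norm nsCH.
rewrite -quotient_cents2 ?(subset_trans (normal_sub nsNH)) //.
have pHC: p.-group (H / C) := quotient_pgroup C pH.
have nsNC: N / C <| H / C := quotient_normal C nsNH.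
have [->|ntNC] := eqVneq (N / C) 1; first exact: sub1G.
have pNC := pgroupS (normal_sub nsNC) pHC.
have [p_pr _ [k oNC]] := pgroup_pdiv pNC ntNC.
rewrite oNC pfactorK // in lNC; case: k => // in oNC lNC.
apply: subset_trans (subsetIr (H / C) _); apply: prime_meetG.
  by rewrite oNC.
exact: meet_center_nil (pgroup_nil pHC) nsNC ntNC.
Qed.

Section PowerMorphism.

Variables (H M : {group gT}).
Hypotheses (p_pr : prime p) (pH : p.-group H) (nsMH : M <| H).
Hypothesis expM : {in M &, {morph (fun u => u ^+ p) : u v / u * v}}.

(** The p-th powers form a nontrivial normal subgroup of H, which meets the
    center in an element of order p. *)
Lemma exists_central_expg : ~~ (exponent M %| p) ->
  exists s, [/\ s \in M, s ^+ p != 1, s ^+ p \in 'Z(H) & s ^+ p ^+ p = 1].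
Proof.
move=> nexp; pose f := Morphism expM; pose P := (f @* M)%G.
have nsPH: P <| H.
  have [sMH nMH] := andP nsMH; apply/andP; split.
    by apply/subsetP=> _ /morphimP[u _ Mu ->]; rewrite groupX // (subsetP sMH).
  apply/subsetP=> h Hh; rewrite inE.
  apply/subsetP=> _ /imsetP[_ /morphimP[u _ Mu ->] ->].
  have Muh: u ^ h \in M by rewrite memJ_norm // (subsetP nMH).
  by rewrite /= conjXg; apply/morphimP; exists (u ^ h).
have ntP: P :!=: 1.
  apply: contra nexp => /eqP P1; apply/exponentP=> u Mu.
  by apply/set1P; rewrite -[[set 1]]P1; apply/morphimP; exists u.
have ntPZ := meet_center_nil (pgroup_nil pH) nsPH ntP.
have pPZ: p.-group (P :&: 'Z(H)).
  exact: pgroupS (subset_trans (subsetIl _ _) (normal_sub nsPH)) pH.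
have [_ pdv _] := pgroup_pdiv pPZ ntPZ.
have [c] := Cauchy p_pr pdv.
rewrite inE => /andP[/morphimP[s _ Ms /= ->] Zc] oc.
exists s; split=> //; last by apply/eqP; rewrite -order_dvdn oc.
by rewrite -order_eq1 oc; case: eqP p_pr => // ->.
Qed.

(** The power map commutes with conjugation, so s^-1 s^x is sent to
    (s^p)^-1 (s^p)^x. *)
Lemma commg_expg1 s x :
  s \in M -> x \in H -> commute (s ^+ p) x -> [~ s, x] ^+ p = 1.
Proof.
move=> Ms Hx csx; have nMx := subsetP (normal_norm nsMH) x Hx.
have Msx: s ^ x \in M by rewrite memJ_norm.
rewrite commgEl expM ?groupV //= -conjXg expgVn.
by rewrite (_ : s ^+ p ^ x = s ^+ p) ?mulVg //; apply/conjg_fixP/commgP.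
Qed.

End PowerMorphism.

End PGroups.

(** * From exponent p to isolation *)

(** The proof shows that N_G(S) has exponent p, which is more than isolation. *)
Lemma exponent_prime_isolated (gT : finGroupType) (p : nat) (G : {group gT}) :
  prime p -> 4 < p -> p.-group G ->
  (forall S : {group gT}, S \subset G -> minimal_nonabelian S ->
     exponent S %| p) ->
  forall S : {group gT}, S \subset G -> minimal_nonabelian S ->
    isolated S 'N_G(S)%G.
Proof.
move=> p_pr p_gt4 pG expG S sSG minS; set H := 'N_G(S)%G.
have pH: p.-group H := pgroupS (subsetIl _ _) pG.
have sSH: S \subset H by rewrite subsetI sSG normG.
have nsSH: S <| H by rewrite /normal sSH subsetIr.
have pS := pgroupS sSG pG.
apply/(isolated_pgroupP p_pr pH sSH) => x Hx _ ntxp.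
have [nabS oS _] := minimal_nonabelian_Sp3 p_pr pS minS (expG S sSG minS).
have l3: logn p #|S| = 3 by rewrite oS pfactorK.
have expS u : u \in S -> u ^+ p = 1 by apply/exponentP/expG.
have [T [sTS nsTH oT]] : exists T : {group gT},
    [/\ T \subset S, T <| H & #|T| = (p ^ 2)%N].
  by apply: normal_pgroup; rewrite ?l3.
have sTH := normal_sub nsTH; have nTH := normal_norm nsTH.
(* [T, H] is a proper subgroup of T normal in H, so its order is at most p. *)
have sTHZ: [~: T, H] \subset 'Z(H).
  have nsR : [~: T, H] <| H.
    by rewrite /normal commg_subr commg_normr (subset_trans sTH) ?normG.
  have pT: p.-group T := pgroupS sTH pH.
  have ltR: logn p #|[~: T, H]| < 2.
    rewrite -(pfactorK 2 p_pr) -oT properG_ltn_log //.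
    rewrite (nil_comm_properl (pgroup_nil pH)) //.
      by rewrite -cardG_gt1 oT -(exp1n 2) ltn_exp2r ?prime_gt1.
    by rewrite subsetI subxx.
  rewrite subsetI (normal_sub nsR); apply/commG1P/trivgP.
  apply: commg_section_prime pH nsR (normal1 _) _.
  by rewrite card_quotient ?indexg1 // norms1.
(* An h not centralizing T lies in a minimal nonabelian subgroup. *)
have minTH t h : t \in T -> h \in H -> [~ t, h] != 1 -> h ^+ p = 1.
  move=> Tt Hh ntth; have Zth: [~ t, h] \in 'Z(H).
    by rewrite (subsetP sTHZ) // mem_commg.
  have [Hth /centP cth] := setIP Zth.
  have sJG: <[t]> <*> <[h]> \subset G.
    rewrite join_subG !cycle_subG (subsetP (subset_trans sTS sSG)) //.
    by rewrite (subsetP (subsetIl _ _) _ Hh).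
  have minJ: minimal_nonabelian (<[t]> <*> <[h]>)%G.
    apply: (minimal_nonabelian_joing p_pr) => //.
    - exact: pgroupS sJG pG.
    - by apply: cth; rewrite (subsetP sTH).
    - exact: cth.
    apply: expS; apply: (subsetP sTS); rewrite -commg_subr in nTH.
    by rewrite -groupV invg_comm (subsetP nTH) ?mem_commg.
  have /exponentP -> // := expG _ sJG minJ.
  by rewrite mem_gen // inE cycle_id orbT.
have sSHT: [~: S, H] \subset T.
  apply: commg_section_prime pH nsSH nsTH _.
  rewrite card_quotient ?(subset_trans sSH) //.
  by rewrite -divgS // logn_div ?cardSg // l3 oT pfactorK.
(* If T were central in S then S, cyclic modulo T, would be abelian. *)
have [t Tt [g Sg nttg]]: exists2 t, t \in T &
    exists2 g, g \in S & [~ t, g] != 1.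
  have /subsetPn[t Tt]: ~~ (T \subset 'C(S)).
    apply: contra nabS => cTS; apply: (@cyclic_factor_abelian _ T).
      by rewrite subsetI sTS.
    apply: prime_cyclic; rewrite card_quotient ?(subset_trans sSH) //.
    by rewrite -divgS // oS oT -expnB ?prime_gt0.
  rewrite -sub_cent1 => /subsetPn[g Sg nCtg]; exists t => //; exists g => //.
  by apply: contra nCtg => /commgP/cent1P; rewrite cent1C.
have Hg: g \in H by rewrite (subsetP sSH).
have cTx t' : t' \in T -> commute t' x.
  by move=> Tt'; apply/commgP; apply: contraR ntxp => /minTH->.
have Ta: [~ x, g] \in T.
  by rewrite -groupV invg_comm (subsetP sSHT) // mem_commg.
have Zd: [~ [~ x, g], g] \in 'Z(H) by rewrite (subsetP sTHZ) // mem_commg.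
have [_ /centP cd] := setIP Zd.
have b1: [~ [~ x, g], x] = 1 by apply/eqP/commgP/cTx.
have gxp: (g * x) ^+ p = x ^+ p.
  rewrite expMg_class3_prime ?(expS g) ?mul1g //.
  - by rewrite b1; apply: commute_sym; apply: commute1.
  - by rewrite b1; apply: commute_sym; apply: commute1.
  - by apply: cd.
  - by apply: cd.
  by apply: expS; apply: (subsetP sTS).
case/eqP: ntxp; rewrite -gxp; apply: (minTH t); rewrite ?groupM //.
rewrite commgMJ (_ : [~ t, x] = 1) ?mul1g; last by apply/eqP/commgP/cTx.
by rewrite -(conj1g x) (inj_eq (conjg_inj x)).
Qed.

(** * From isolation to exponent p *)

Section Isolation.

Variable gT : finGroupType.
Implicit Types (u v x : gT) (G H K M S : {group gT}).

(** The subgroup R generated by a and x is minimal nonabelian, s normalizes it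
    and s^3 is a nontrivial element of R. So s would lie in R by isolation, and
    then a = [s, x] in R' would commute with x. *)
Lemma three_uniserial_contradiction G s x (a := [~ s, x]) (d := [~ a, x]) :
  3.-group G ->
  (forall S, S \subset G -> minimal_nonabelian S -> isolated S 'N_G(S)%G) ->
  s \in G -> x \in G -> commute a s -> d != 1 -> commute d a -> commute d x ->
  d ^+ 3 = 1 -> s ^+ 3 = d^-1 -> False.
Proof.
move=> pG isoG Gs Gx cas ntd cda cdx d3 s3.
pose R := (<[a]> <*> <[x]>)%G.
have Ra: a \in R by rewrite mem_gen // inE cycle_id.
have Rx: x \in R by rewrite mem_gen // inE cycle_id orbT.
have sRG: R \subset G by rewrite join_subG !cycle_subG groupR.
have minR: minimal_nonabelian R.
  by apply: (@minimal_nonabelian_joing _ 3) => //; apply: pgroupS sRG pG.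
have pN: 3.-group 'N_G(R)%G := pgroupS (subsetIl _ _) pG.
have sRN: R \subset 'N_G(R)%G by rewrite subsetI sRG normG.
have Rs: s \in R.
  have /(isolated_pgroupP _ pN sRN) iso := isoG R sRG minR; apply: iso => //.
  - rewrite inE Gs /= inE -genJ gen_subG conjUg subUset -!cycleJ !cycle_subG.
    rewrite (_ : a ^ s = a) ?Ra; last by apply/conjg_fixP/commgP.
    by rewrite conjg_mulR groupM // -invg_comm groupV.
  - by rewrite s3 groupV groupR.
  by rewrite s3 eq_invg1.
case/eqP: ntd; apply/eqP/commgP.
have: a \in R^`(1) by rewrite mem_commg.
rewrite der1_joing_cycles; last first.
  rewrite -sub_cent1 join_subG !cycle_subG.
  by apply/andP; split; apply/cent1P.
by case/cycleP=> k ->; apply/commute_sym/commuteX/commute_sym.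
Qed.

(** Let W be the kernel of the power map, P its image, c = s^p and C the
    subgroup generated by c and S', all central in H. Since P S' is the
    Frattini subgroup, |S : P S'| is at most p^2 and |W| = |S : P| is at most
    p^3 / |P :&: S'|, while |C| = p^2 / |<c> :&: S'|. As c is in P, the index
    of C in W is at most p, so H acts trivially on W / C. *)
Lemma commg_ker_expg_central p H S s
    (fM : {in S &, {morph (fun u => u ^+ p) : u v / u * v}}) :
  prime p -> p.-group H -> S <| H -> minimal_nonabelian S ->
  s \in S -> s ^+ p != 1 -> s ^+ p \in 'Z(H) -> s ^+ p ^+ p = 1 ->
  [~: 'ker (Morphism fM), H] \subset 'Z(H).
Proof.
move=> p_pr pH nsSH minS Ss ntc Zc cp1.
have sSH := normal_sub nsSH; have pS := pgroupS sSH pH.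
have [_ oS' lS] := minimal_nonabelian_pgroup p_pr pS minS.
set f := Morphism fM; set c := s ^+ p in ntc Zc cp1.
have kerE u : (u \in 'ker f) = (u \in S) && (u ^+ p == 1).
  by rewrite inE /= !inE.
have S'Z: S^`(1) \subset 'Z(H).
  have nsS'H: S^`(1) <| H by apply: char_normal_trans (der_char 1 S) nsSH.
  rewrite subsetI (normal_sub nsS'H); apply/commG1P/trivgP.
  apply: commg_section_prime pH nsS'H (normal1 _) _.
  by rewrite card_quotient ?indexg1 ?norms1 // oS' (pfactorK 1).
pose C := (<[c]> * S^`(1))%G.
have oC : #|<[c]>| = p by apply: nt_prime_order.
have CE: C = <[c]> * S^`(1) :> {set gT}.
  rewrite /= norm_joinEr //; apply: cents_norm; rewrite centsC cycle_subG.
  case/setIP: Zc => _ cH; apply: subsetP cH; apply: centS.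
  by rewrite (subset_trans (der_sub 1 S)).
have sCZ: C \subset 'Z(H) by rewrite join_subG cycle_subG Zc.
have nsCH: C <| H by apply: sub_center_normal.
have S'1 u : u \in S^`(1) -> u ^+ p = 1.
  by move=> S'u; rewrite -oS' expg_cardG.
have sCk: C \subset 'ker f.
  rewrite join_subG cycle_subG; apply/andP; split.
    by rewrite kerE /c groupX //= cp1.
  by apply/subsetP=> u S'u; rewrite kerE (subsetP (der_sub 1 S)) //= S'1.
have nskH: 'ker f <| H.
  rewrite /normal (subset_trans _ sSH) ?subsetIl //=.
  apply/subsetP=> h Hh; rewrite inE; apply/subsetP=> _ /imsetP[u ku ->].
  move: ku; rewrite !kerE => /andP[Su /eqP up].
  rewrite memJ_norm ?Su -?conjXg ?up ?conj1g //=.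
  exact: subsetP (normal_norm nsSH) h Hh.
apply: subset_trans sCZ; apply: (commg_section_prime pH nskH nsCH).
pose P := (f @* S)%G.
have PE : P = 'Mho^1(S) :> {set gT}.
  apply/eqP; rewrite eqEsubset (MhoE 1 pS) expn1; apply/andP; split.
    apply/subsetP=> _ /morphimP[u _ Su ->].
    by rewrite mem_gen //; apply: imset_f.
  rewrite gen_subG; apply/subsetP=> _ /imsetP[u Su ->].
  by apply/morphimP; exists u.
have sPS: P \subset S by rewrite PE Mho_sub.
have PhiE: 'Phi(S) = S^`(1) * P.
  by rewrite (Phi_joing pS) PE norm_joinEr // normsRl ?Mho_sub.
have gt0 := cardG_gt0.
have e1: (logn p #|S| = logn p #|'ker f| + logn p #|P|)%N.
  have := card_morphim f S.
  rewrite (setIidPr (subxx S)) -divgS ?subsetIl // => oP.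
  by rewrite -lognM // mulnC /P /= oP divnK ?cardSg ?subsetIl.
have e2: (logn p #|S| = logn p #|'Phi(S)| + logn p #|S / 'Phi(S)|)%N.
  by rewrite card_quotient ?gFnorm // -lognM // Lagrange ?Phi_sub.
have e3: (1 + logn p #|P| = logn p #|'Phi(S)| + logn p #|S^`(1) :&: P|)%N.
  by rewrite -lognM // PhiE -mul_cardG lognM // oS' (pfactorK 1).
have e4: (2 = logn p #|C| + logn p #|<[c]> :&: S^`(1)|)%N.
  by rewrite -lognM // CE -mul_cardG lognM // oS' oC (pfactorK 1).
have e5: (logn p #|<[c]> :&: S^`(1)| <= logn p #|S^`(1) :&: P|)%N.
  apply: dvdn_leq_log => //; apply: cardSg.
  rewrite /= setIC setIS // cycle_subG.
  by apply/morphimP; exists s.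
rewrite card_quotient ?(subset_trans (normal_sub nskH)) ?normal_norm //.
have arith (m w q n r k i j : nat) :
    (m = w + q -> m = n + r -> 1 + q = n + i -> 2 = k + j ->
     j <= i -> r <= 2 -> w - k <= 1)%N.
  by clear; lia.
by rewrite -divgS // logn_div ?cardSg //; apply: arith e1 e2 e3 e4 e5 lS.
Qed.

(** All elements of a coset x S have order p; if S did not have exponent p, an s
    with s^p central and nontrivial would violate the expansion of (x s)^p, or
    for p = 3 lead to the configuration excluded above. *)
Lemma isolated_exponent_minimal_nonabelian p G S :
  prime p -> p.-group G ->
  (forall R : {group gT}, R \subset G -> minimal_nonabelian R ->
     isolated R 'N_G(R)%G) ->
  S \proper G -> minimal_nonabelian S -> exponent S %| p.
Proof.
move=> p_pr pG isoG prSG minS; have sSG := proper_sub prSG.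
have [nabS _] := minS; have pS := pgroupS sSG pG.
have [x [Nx _ xS]] := isolated_coset_expg1 p_pr pG prSG (isoG S sSG minS).
have p_neq2: p != 2 by apply: coset_expg1_odd nabS xS; case/setIP: Nx.
have fM := minimal_nonabelian_expMn p_pr p_neq2 pS minS.
set H := 'N_G(S)%G; have pH : p.-group H := pgroupS (subsetIl _ _) pG.
have nsSH: S <| H by rewrite /normal subsetI sSG normG subsetIr.
apply/negPn/negP=> nexp.
have [s [Ss nts Zs sp1]] := exists_central_expg p_pr pH nsSH fM nexp.
have sZH := commg_ker_expg_central fM p_pr pH nsSH minS Ss nts Zs sp1.
have Hs: s \in H := subsetP (normal_sub nsSH) s Ss.
have [_ /centP cs] := setIP Zs.
have xp1: x ^+ p = 1 by rewrite -(mulg1 x) xS.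
pose a := [~ s, x]; pose b := [~ a, s]; pose d := [~ a, x].
have nSx := subsetP (normal_norm nsSH) x Nx.
have Sa : a \in S by rewrite groupMl ?groupV // memJ_norm.
have ap1: a ^+ p = 1 by apply: (commg_expg1 nsSH fM Ss Nx); apply: cs.
have Ka : a \in 'ker (Morphism fM) by rewrite inE Sa inE /= ap1 inE.
have Zb : b \in 'Z(H) by rewrite (subsetP sZH) // mem_commg.
have Zd : d \in 'Z(H) by rewrite (subsetP sZH) // mem_commg.
have [[Hb /centP cb] [Hd /centP cd]] := (setIP Zb, setIP Zd).
have Ha : a \in H := subsetP (normal_sub nsSH) a Sa.
have [p_gt4 | p_le4] := ltnP 4 p.
  case/eqP: nts; rewrite -[LHS]mul1g -xp1 -expMg_class3_prime ?xS //.
  - exact: cb.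
  - exact: cb.
  - exact: cd.
  - exact: cd.
have p3: p = 3 by case: (p) p_pr p_neq2 p_le4 => [|[|[|[|[|]]]]].
subst p.
have eq1: s ^+ 3 * d * b ^+ 2 = 1.
  by apply: expMg_class3_three ap1 xp1 (xS s Ss); first [exact: cb | exact: cd].
have b3: b ^+ 3 = 1.
  by rewrite -commXg ?ap1 ?comm1g //; apply/commute_sym/cb.
have d3: d ^+ 3 = 1.
  by rewrite -commXg ?ap1 ?comm1g //; apply/commute_sym/cd.
have [aV bV dV] :
    [/\ [~ s^-1, x] = b * a^-1, [~ b * a^-1, s^-1] = b
       & [~ b * a^-1, x] = d^-1].
  by apply: commVg_class3; first [by [] | exact: cb | exact: cd].
have eq2: s^-1 ^+ 3 * d^-1 * b ^+ 2 = 1.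
  have aV3 : [~ s^-1, x] ^+ 3 = 1.
    apply: (commg_expg1 nsSH fM) => //; rewrite ?groupV // expgVn.
    exact/commute_sym/commuteV/commute_sym/cs.
  have := @expMg_class3_three _ s^-1 x.
  rewrite aV bV dV; apply=> //; last by rewrite xS ?groupV.
  - by apply: cb; rewrite groupV.
  - exact: cb.
  - by apply/commute_sym/commuteV/commute_sym/cd; rewrite groupV.
  - by apply/commute_sym/commuteV/commute_sym/cd.
  by rewrite -aV.
(* The two cubes multiply to b^4 = 1, and b^3 = 1. *)
have b1: b = 1.
  have b4: b = b ^+ 2 * b ^+ 2 by rewrite -expgD (expgD b 3 1) b3 mul1g.
  move/eqP: eq1 eq2; rewrite -eq_invg_mul => /eqP e1 /eqP.
  rewrite -eq_invg_mul invMg expgVn !invgK => /eqP e2.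
  by rewrite b4 -{1}e2 -e1 (cd _ (groupX 3 Hs)) mulgV.
have s3 : s ^+ 3 = d^-1.
  by apply: (mulIg d); rewrite mulVg -eq1 b1 expg1n mulg1.
apply: (@three_uniserial_contradiction G s x pG isoG) => //.
- exact: subsetP sSG s Ss.
- by case/setIP: Nx.
- by apply/commgP; rewrite -/b b1.
- by rewrite -eq_invg1 -s3.
- exact: cd.
- exact: cd.
Qed.

(** Let K be minimal among the nonabelian subgroups of exponent greater than 3.
    An element of K with nontrivial cube lies in a maximal subgroup, which is
    abelian by minimality. If two distinct such subgroups M and M2 existed, K'
    would be central and K would contain a minimal nonabelian subgroup with
    nontrivial cubes. So outside one of them, M, all cubes are trivial, and
    (g s)^3 = 1 for s in M and g outside M gives s^3 [[s, g], g] = 1 whenever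
    [s, g]^3 = 1. *)
Lemma isolated_exponent_three G :
  3.-group G -> ~~ abelian G ->
  (forall S, S \subset G -> minimal_nonabelian S -> isolated S 'N_G(S)%G) ->
  (forall S, S \subset G -> minimal_nonabelian S -> exponent S %| 3) ->
  exponent G %| 3.
Proof.
move=> pG nabG isoG expG; apply/negPn/negP=> nexpG.
pose P (K : {group gT}) :=
  [&& K \subset G, ~~ abelian K & ~~ (exponent K %| 3)].
have PG : P G by rewrite /P subxx nabG.
have [K minK _] := mingroup_exists PG.
have /and3P[sKG nabK nexpK] := mingroupp minK.
have pK := pgroupS sKG pG.
have abK M : M \proper K -> ~~ (exponent M %| 3) -> abelian M.
  move=> prM nexpM; apply/negPn/negP=> nabM.
  have PM: P M by rewrite /P (subset_trans (proper_sub prM)) ?nabM.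
  by have := prM; rewrite (mingroupP minK).2 ?properxx ?proper_sub.
have max_over u : u \in K -> u ^+ 3 != 1 ->
  exists M, [/\ maximal M K, u \in M, abelian M & ~~ (exponent M %| 3)].
  move=> Ku ntu; have sK: <[u]> \subset K by rewrite cycle_subG.
  have [eK | [M maxM]] := maximal_exists sK.
    by rewrite -eK cycle_abelian in nabK.
  rewrite cycle_subG => Mu; exists M.
  have nexpM : ~~ (exponent M %| 3).
    by apply: contra ntu => /exponentP/(_ u Mu)->.
  by split=> //; apply: abK (maxgroupp maxM) nexpM.
have [x0 Kx0 ntx0] : exists2 u, u \in K & u ^+ 3 != 1.
  apply/exists_inP; apply: contraR nexpK => /exists_inPn h.
  by apply/exponentP=> u /h /negPn/eqP.
have [M [maxM _ abM nexpM]] := max_over x0 Kx0 ntx0.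
have nsMK := p_maximal_normal pK maxM; have prMK := maxgroupp maxM.
have sMK := normal_sub nsMK.
have gen_max (L : {group gT}) g :
    M \subset L -> L \subset K -> g \in L -> g \notin M -> L :=: K.
  move=> sML sLK Lg nMg; apply/eqP; apply: contraR nMg => neLK.
  have /maxgroupP[_ maxP] := maxM.
  by rewrite -(maxP L) // properEneq neLK.
have cube_M g : g \in K -> g ^+ 3 \in M.
  move=> Kg; apply: (subsetP (Phi_sub_max maxM)).
  rewrite (Phi_joing pK) mem_gen // inE; apply/orP; right.
  by apply: (Mho_p_elt 1) => //; apply: mem_p_elt pK Kg.
have [g Kg nMg] : exists2 g, g \in K & g \notin M by case/properP: prMK.
have cube1 h : h \in K -> h \notin M -> h ^+ 3 = 1.
  move=> Kh nMh; apply/eqP/negPn/negP=> nth.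
  have [M2 [maxM2 M2h abM2 _]] := max_over h Kh nth.
  have nsM2 := p_maximal_normal pK maxM2.
  (* Elements of the intersection of M and M2 centralize M and h, hence K. *)
  have centK z : z \in M -> z \in M2 -> z \in 'C(K).
    move=> Mz M2z; rewrite -sub_cent1.
    have /= eK: 'C_K[z]%G :=: K.
      apply: (gen_max _ h) => //.
      - by rewrite subsetI sMK sub_cent1 (subsetP abM).
      - exact: subsetIl.
      by rewrite inE Kh; apply/cent1P; apply: (centsP abM2).
    by rewrite -eK subsetIr.
  have [u Mu ntuh] : exists2 u, u \in M & [~ u, h] != 1.
    apply/exists_inP; apply: contraR nabK => /exists_inPn cMh.
    have /= eK: 'C_K(M)%G :=: K.
      apply: (gen_max _ h) => //; first by rewrite subsetI sMK.
        exact: subsetIl.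
      rewrite inE Kh; apply/centP=> u Mu; apply/commute_sym/commgP.
      exact/negPn/cMh.
    apply: (@cyclic_factor_abelian _ M).
      by rewrite subsetI sMK centsC -eK subsetIr.
    apply: prime_cyclic; rewrite card_quotient ?normal_norm //.
    by rewrite (p_maximal_index pK maxM).
  have Ku := subsetP sMK u Mu.
  have cz : [~ u, h] \in 'C(K).
    apply: centK.
      rewrite commgEl groupMl ?groupV // memJ_norm //.
      exact: subsetP (normal_norm nsMK) h Kh.
    rewrite commgEr groupMr // memJ_norm ?groupV //.
    exact: subsetP (normal_norm nsM2) u Ku.
  have sJ : <[u]> <*> <[h]> \subset G.
    by rewrite (subset_trans _ sKG) // join_subG !cycle_subG Ku.
  have minJ: minimal_nonabelian (<[u]> <*> <[h]>)%G.
    apply: (@minimal_nonabelian_joing _ 3) => //.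
    - exact: pgroupS sJ pG.
    - exact: (centP cz).
    - exact: (centP cz).
    rewrite -commgX; last by apply/commute_sym/(centP cz).
    by apply/eqP/commgP; apply: (centsP abM) => //; apply: cube_M.
  case/eqP: nth; apply: (exponentP (expG _ sJ minJ)).
  by rewrite mem_gen // inE cycle_id orbT.
have fM : {in M &, {morph (fun u => u ^+ 3) : u v / u * v}}.
  by move=> u v Mu Mv; apply: expgMn; apply: (centsP abM).
have [s [Ms nts /setIP[_ /centP cs] s33]] :=
  exists_central_expg (isT : prime 3) pK nsMK fM nexpM.
have Ks := subsetP sMK s Ms.
pose a := [~ s, g]; pose d := [~ a, g].
have MR u : u \in M -> [~ u, g] \in M.
  move=> Mu; rewrite commgEl groupMl ?groupV // memJ_norm //.
  exact: subsetP (normal_norm nsMK) g Kg.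
have Ma := MR s Ms; have Md := MR a Ma.
have a3: a ^+ 3 = 1 by apply: (commg_expg1 nsMK fM Ms Kg); apply: cs.
have ds: s ^+ 3 * d = 1.
  have g3 := cube1 g Kg nMg.
  have gs3 : (g * s) ^+ 3 = 1.
    by apply: cube1; [rewrite groupM | rewrite groupMr].
  (* Here (g s)^3 = g^3 s^(g^2) s^g s, a product in the abelian group M. *)
  have norm1: s ^ (g * g) * s ^ g * s = 1.
    rewrite -gs3 -[LHS]mul1g -g3 !expgS expg0 !mulg1 !conjgE !invMg.
    by rewrite -!mulgA !mulKVg.
  have sg : s ^ g = s * a by rewrite conjg_mulR.
  have ag : a ^ g = a * d by rewrite conjg_mulR.
  have a3s3 : (s * a) ^+ 3 = s ^+ 3.
    by rewrite expgMn ?a3 ?mulg1 //; apply: (centsP abM).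
  have cubeE (u v w : gT) : commute (v * w) (u * (v * u)) ->
      (u * v) ^+ 3 * w = u * v * (v * w) * (u * v) * u.
    by move=> c; rewrite !expgS expg0 mulg1 -!mulgA (mulgA v w) c -!mulgA.
  have norm2: s * a * (a * d) * (s * a) * s = 1.
    by rewrite -norm1 conjgM !sg conjMg sg ag.
  have cad: commute (a * d) (s * (a * s)).
    apply: (centsP abM); first exact: groupM.
    by apply: groupM => //; apply: groupM.
  by rewrite -a3s3 -norm2; apply: cubeE.
have s3 : s ^+ 3 = d^-1 by apply: (mulIg d); rewrite mulVg ds.
have dE : d = (s ^+ 3)^-1 by rewrite s3 invgK.
apply: (@three_uniserial_contradiction G s g pG isoG) => //.
- exact: subsetP sKG s Ks.
- exact: subsetP sKG g Kg.
- exact: (centsP abM).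
- by rewrite -/a -/d -eq_invg1 -s3.
- exact: (centsP abM).
- by rewrite -/a -/d dE; apply/commute_sym/commuteV/commute_sym/cs.
- by rewrite -/a -/d dE expgVn s33 invg1.
Qed.

End Isolation.

Theorem theorem6 (p : nat) (gT : finGroupType) (G : {group gT})
    (p_prime : prime p) (pG : (p.-group G)%g) (nabG : ~~ abelian G)
    (expG : (p < exponent G)%N) (nminG : ~ minimal_nonabelian G) :
  (forall S : {group gT}, S \subset G -> minimal_nonabelian S ->
     isolated S 'N_G(S)%G)
  <->
  ((5 <= p)%N /\
   exists (rT : finGroupType) (T : {group rT}), is_Sp3 p T /\
     forall S : {group gT}, S \subset G -> minimal_nonabelian S ->
       (S \isog T)%g).
Proof.
split=> [isoG | [p_gt4 [rT [T [[_ _ eT] isoT]]]]]; last first.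
  apply: (exponent_prime_isolated p_prime p_gt4 pG) => S sSG minS.
  by rewrite (exponent_isog (isoT S sSG minS)) eT.
have prG (S : {group gT}) : S \subset G -> minimal_nonabelian S -> S \proper G.
  move=> sSG minS; rewrite properEneq sSG andbT; apply/eqP=> eSG.
  by apply: nminG; rewrite -(_ : S = G) //; apply: val_inj.
have expS (S : {group gT}) :
  S \subset G -> minimal_nonabelian S -> exponent S %| p.
  move=> sSG minS; have prSG := prG S sSG minS.
  exact: isolated_exponent_minimal_nonabelian p_prime pG isoG prSG minS.
have Sp3 (S : {group gT}) : S \subset G -> minimal_nonabelian S -> is_Sp3 p S.
  move=> sSG minS; have pS := pgroupS sSG pG.
  exact: minimal_nonabelian_Sp3 p_prime pS minS (expS S sSG minS).
have [T sTG minT] := minimal_nonabelian_exists nabG.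
split; last first.
  have to_p12 (S : {group gT}) :
    S \subset G -> minimal_nonabelian S -> S \isog p^{1+2}.
    move=> sSG minS; have [nabS oS eS] := Sp3 S sSG minS.
    apply: isog_pX1p2 => //; last by rewrite eS.
    by apply: p3group_extraspecial (pgroupS sSG pG) nabS _; rewrite oS pfactorK.
  exists gT, T; split=> [|S sSG minS]; first exact: Sp3.
  by apply: isog_trans (to_p12 S sSG minS) _; rewrite isog_sym to_p12.
have p_neq2: p != 2.
  have [x [/setIP[_ nTx] _ xT]] :=
    isolated_coset_expg1 p_prime pG (prG T sTG minT) (isoG T sTG minT).
  exact: coset_expg1_odd nTx minT.1 xT.
have p_neq3: p != 3.
  apply: contraTneq expG => p3; subst p; rewrite -leqNgt.
  by apply: dvdn_leq => //; apply: isolated_exponent_three.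
by case: (p) p_prime p_neq2 p_neq3 => [|[|[|[|[|]]]]].
Qed.
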